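(* Let $F$ be a field of characteristic not $2$ and not $3$, let $\alpha,t\in F$, and let $E$ be a vector space over $F$ (of any dimension) endowed with a nondegenerate symmetric bilinear form $\langle\cdot,\cdot\rangle$. Then the algebra $S(\alpha,t,E)$ satisfies the identity $$((a,b,c),d,b)+((c,b,d),a,b)+((d,b,a),c,b)=0$$ for all $a,b,c,d\in S(\alpha,t,E)$, where $(x,y,z)=(xy)z-x(yz)$ denotes the associator.
   Context: $S(\alpha,t,E)=Fz_1\oplus Fz_2\oplus E$ is the commutative (nonassociative) $F$-algebra with bilinear product determined by $z_1^2=z_1$, $z_2^2=z_2$, $z_1z_2=0$, $ez_1=\alpha e$, $ez_2=(1-\alpha)e$, $ef=\langle e,f\rangle(z_1+tz_2)$ for $e,f\in E$. *)

(* Defs.v *)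
From HB Require Import structures.
From mathcomp Require Import all_boot all_order all_algebra ring.

Set Implicit Arguments.
Unset Strict Implicit.
Unset Printing Implicit Defensive.

Import GRing.Theory.
Local Open Scope ring_scope.

(* The library's [nondegenerate] requires a finite-dimensional [vectType]. *)
Definition nondegenerate_form (F : fieldType) (E : lmodType F)
    (B : {symmetric E}) : Prop :=
  forall e : E, (forall f : E, B e f = 0) -> e = 0.

(* The triple (x1, x2, e) stands for x1 z1 + x2 z2 + e. *)
Definition spin_space (F : fieldType) (E : lmodType F) : lmodType F :=
  (F^o * F^o * E)%type.

Definition z1 {F : fieldType} {E : lmodType F} : spin_space E := (1, 0, 0).
Definition z2 {F : fieldType} {E : lmodType F} : spin_space E := (0, 1, 0).
Definition emb {F : fieldType} {E : lmodType F} (e : E) : spin_space E :=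
  (0, 0, e).

(* The product of S(alpha, t, E); [spin_mulE] and the lemmas before it show
   that it is the unique bilinear commutative product with the defining
   multiplication table. *)
Definition spin_mul (F : fieldType) (alpha t : F) (E : lmodType F)
    (B : {symmetric E}) (x y : spin_space E) : spin_space E :=
  let: (x1, x2, e) := x in
  let: (y1, y2, f) := y in
  (x1 * y1 + B e f,
   x2 * y2 + t * B e f,
   (alpha * x1 + (1 - alpha) * x2) *: f + (alpha * y1 + (1 - alpha) * y2) *: e).

Definition associator (V : zmodType) (mul : V -> V -> V) (x y z : V) : V :=
  mul (mul x y) z - mul x (mul y z).

Lemma symmetric_formC (F : fieldType) (E : lmodType F) (B : {symmetric E})
  (e f : E) : B e f = B f e.
Proof. by rewrite hermC expr0 mul1r. Qed.

Lemma spin_mulC (F : fieldType) (alpha t : F) (E : lmodType F)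
  (B : {symmetric E}) : commutative (spin_mul alpha t B).
Proof.
move=> [[x1 x2] e] [[y1 y2] f] /=.
by rewrite (symmetric_formC B e f) (mulrC x1) (mulrC x2) [X in (_, X)]addrC.
Qed.

Lemma spin_addE (F : fieldType) (E : lmodType F) (x1 x2 y1 y2 : F) (e f : E) :
  (x1, x2, e) + (y1, y2, f) = (x1 + y1, x2 + y2, e + f) :> spin_space E.
Proof. by []. Qed.

Lemma spin_scaleE (F : fieldType) (E : lmodType F) (c x1 x2 : F) (e : E) :
  c *: ((x1, x2, e) : spin_space E) = (c * x1, c * x2, c *: e).
Proof. by []. Qed.

Lemma spin_mul_linear (F : fieldType) (alpha t : F) (E : lmodType F)
  (B : {symmetric E}) (x : spin_space E) : linear (spin_mul alpha t B x).
Proof.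
case: x => [[x1 x2] e] c [[y1 y2] f] [[w1 w2] g].
rewrite spin_scaleE spin_addE /spin_mul spin_scaleE spin_addE.
rewrite (linearPr B e c f g) /=; congr (_, _, _); [ring | ring |].
rewrite !scalerDr !scalerA -!addrA; congr (_ + _); first by rewrite mulrC.
rewrite [in RHS]addrCA; congr (_ + _).
by rewrite -scalerDl; congr (_ *: _); ring.
Qed.

Lemma spin_mul_z1z1 (F : fieldType) (alpha t : F) (E : lmodType F)
  (B : {symmetric E}) : spin_mul alpha t B z1 z1 = z1.
Proof. by rewrite /spin_mul /= linear0l !scaler0 !mulr1 !mulr0 !addr0. Qed.

Lemma spin_mul_z2z2 (F : fieldType) (alpha t : F) (E : lmodType F)
  (B : {symmetric E}) : spin_mul alpha t B z2 z2 = z2.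
Proof. by rewrite /spin_mul /= linear0l !scaler0 !mulr1 !mulr0 !addr0. Qed.

Lemma spin_mul_z1z2 (F : fieldType) (alpha t : F) (E : lmodType F)
  (B : {symmetric E}) : spin_mul alpha t B z1 z2 = 0.
Proof. by rewrite /spin_mul /= linear0l !scaler0 mul0r !mulr0 !addr0. Qed.

Lemma spin_mul_Ez1 (F : fieldType) (alpha t : F) (E : lmodType F)
  (B : {symmetric E}) (e : E) :
  spin_mul alpha t B (emb e) z1 = alpha *: emb e.
Proof.
rewrite spin_scaleE /spin_mul /= linear0r.
by rewrite scaler0 !mul0r !mulr0 mulr1 !addr0 add0r.
Qed.

Lemma spin_mul_Ez2 (F : fieldType) (alpha t : F) (E : lmodType F)
  (B : {symmetric E}) (e : E) :
  spin_mul alpha t B (emb e) z2 = (1 - alpha) *: emb e.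
Proof.
rewrite spin_scaleE /spin_mul /= linear0r.
by rewrite scaler0 !mul0r !mulr0 mulr1 !addr0 !add0r.
Qed.

Lemma spin_mul_EE (F : fieldType) (alpha t : F) (E : lmodType F)
  (B : {symmetric E}) (e f : E) :
  spin_mul alpha t B (emb e) (emb f) = B e f *: (z1 + t *: z2).
Proof.
rewrite /z1 /z2 (spin_scaleE t) spin_addE spin_scaleE /spin_mul /=.
rewrite !(mulr0, mulr1, addr0, add0r, scale0r, scaler0).
by congr (_, _, _); rewrite mulrC.
Qed.

Lemma spin_decomp (F : fieldType) (E : lmodType F) (x : spin_space E) :
  x = x.1.1 *: z1 + x.1.2 *: z2 + emb x.2.
Proof.
case: x => [[x1 x2] e]; rewrite /z1 /z2 /emb !spin_scaleE !spin_addE /=.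
by rewrite !scaler0 !mulr0 !mulr1 !addr0 !add0r.
Qed.

Lemma spin_mulE (F : fieldType) (alpha t : F) (E : lmodType F)
  (B : {symmetric E})
  (m : {bilinear spin_space E -> spin_space E -> spin_space E}) :
  commutative m ->
  m z1 z1 = z1 -> m z2 z2 = z2 -> m z1 z2 = 0 ->
  (forall e : E, m (emb e) z1 = alpha *: emb e) ->
  (forall e : E, m (emb e) z2 = (1 - alpha) *: emb e) ->
  (forall e f : E, m (emb e) (emb f) = B e f *: (z1 + t *: z2)) ->
  forall x y : spin_space E, m x y = spin_mul alpha t B x y.
Proof.
move=> mC m11 m22 m12 me1 me2 mee x y.
rewrite [in LHS](spin_decomp x) [in LHS](spin_decomp y).
rewrite !(linearDl, linearDr, linearZl_LR, linearZr_LR) /=.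
rewrite m11 m22 m12 (mC z2 z1) m12 !(mC _ (emb y.2)) !me1 !me2.
rewrite (mC (emb y.2)) mee.
have ext (u v : spin_space E) :
  u.1.1 = v.1.1 -> u.1.2 = v.1.2 -> u.2 = v.2 -> u = v.
  by case: u v => [[? ?] ?] [[? ?] ?] /= -> -> ->.
have add11 (u v : spin_space E) : (u + v).1.1 = u.1.1 + v.1.1 by [].
have add12 (u v : spin_space E) : (u + v).1.2 = u.1.2 + v.1.2 by [].
have add2 (u v : spin_space E) : (u + v).2 = u.2 + v.2 by [].
have scale11 c (u : spin_space E) : (c *: u).1.1 = c * u.1.1 by [].
have scale12 c (u : spin_space E) : (c *: u).1.2 = c * u.1.2 by [].
have scale2 c (u : spin_space E) : (c *: u).2 = c *: u.2 by [].
case: x y => [[x1 x2] e] [[y1 y2] f]; rewrite !scaler0.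
apply: ext.
- by rewrite !(add11, scale11) /=; ring.
- by rewrite !(add12, scale12) /=; ring.
rewrite !(add2, scale2) /= !scaler0 !(addr0, add0r) !scalerA -!scalerDl.
by rewrite scaler0 addr0; congr (_ *: _ + _ *: _); ring.
Qed.

(* Main.v *)
Require Import Defs.
From mathcomp Require Import all_boot all_order all_algebra.
From mathcomp Require Import ring.

Import GRing.Theory.
Local Open Scope ring_scope.

(** Put [delta x = x1 - x2] and let [q] be the symmetric bilinear form
    [q x y = alpha (1 - alpha) delta x delta y + (alpha + (1 - alpha) t) <e_x, e_y>].
    The [E]-component of [(x, y, z)] is [q x y e_z - q y z e_x], and its scalar
    components are multiples of [<e_x, e_y> delta z - <e_y, e_z> delta x].
    Each component of the left-hand side of the identity is then a combination
    of sums, over the cyclic permutations of [(a, c, d)], of products of values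
    of symmetric forms, and these sums telescope. *)

Definition spin_diff {F : fieldType} {E : lmodType F} (x : spin_space E) : F :=
  x.1.1 - x.1.2.

Definition spin_form {F : fieldType} (alpha t : F) {E : lmodType F}
    (B : {symmetric E}) (x y : spin_space E) : F :=
  alpha * (1 - alpha) * (spin_diff x * spin_diff y)
  + (alpha + (1 - alpha) * t) * B x.2 y.2.

(** On [E], [x] acts as the scalar [lambda x = alpha * x1 + (1 - alpha) * x2]. These scalars
    commute, so the [y.2] terms cancel, and [spin_form] is the defect
    [lambda (x y) - lambda x * lambda y]. *)
Lemma spin_associatorE (F : fieldType) (alpha t : F) (E : lmodType F)
    (B : {symmetric E}) (x y z : spin_space E) :
  let k := B x.2 y.2 * spin_diff z - B y.2 z.2 * spin_diff x in
  associator (spin_mul alpha t B) x y z =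
  ((1 - alpha) * k, - (alpha * t * k),
   spin_form alpha t B x y *: z.2 - spin_form alpha t B y z *: x.2).
Proof.
case: x y z => [[x1 x2] e] [[y1 y2] f] [[w1 w2] g].
have subE (u1 u2 v1 v2 : F) (u v : E) :
  ((u1, u2, u) : spin_space E) - (v1, v2, v) = (u1 - v1, u2 - v2, u - v) by [].
rewrite /associator /spin_form /spin_diff [LHS]subE /=.
rewrite !(linearDl, linearDr, linearZl_LR, linearZr_LR) /=.
rewrite (symmetric_formC B e g); congr (_, _, _); [ring | ring |].
rewrite !scalerDr !scalerA [w in _ + w - _]addrC.
rewrite [X in _ - (X + _)]addrC [X in _ - (X *: f + _ + _)]mulrC !opprD !addrA addrK.
rewrite [X in X - _]addrAC -scalerBl -addrA -scalerBl -scaleNr.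
by congr (_ *: _ + _ *: _); ring.
Qed.

Lemma spin_formC (F : fieldType) (alpha t : F) (E : lmodType F)
    (B : {symmetric E}) (x y : spin_space E) :
  spin_form alpha t B x y = spin_form alpha t B y x.
Proof. by rewrite /spin_form symmetric_formC [spin_diff x * _]mulrC. Qed.

Theorem theorem3 (F : fieldType) (alpha t : F) (E : lmodType F)
    (B : {symmetric E}) (a b c d : spin_space E) :
  2%N \notin [pchar F] -> 3%N \notin [pchar F] ->
  nondegenerate_form B ->
  let asc := associator (spin_mul alpha t B) in
  asc (asc a b c) d b + asc (asc c b d) a b + asc (asc d b a) c b = 0.
Proof.
move=> _ _ _ asc; rewrite /asc.
have BC := symmetric_formC B.
have qC := spin_formC F alpha t E B.
rewrite !spin_associatorE !spin_addE /=.
have -> : (0 : spin_space E) = (0, 0, 0) by [].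
congr (_, _, _).
- rewrite !(linearBl, linearZl_LR) /spin_form /spin_diff /=.
  rewrite !(BC b.2) (BC d.2 a.2) (BC d.2 c.2) (BC c.2 a.2); ring.
- rewrite !(linearBl, linearZl_LR) /spin_form /spin_diff /=.
  rewrite !(BC b.2) (BC d.2 a.2) (BC d.2 c.2) (BC c.2 a.2); ring.
rewrite [_ - _ + (_ - _)]addrACA [LHS]addrACA -!scalerDl.
(* This [q] is the total coefficient of [b.2], not the form; its [spin_diff] and [B] parts vanish
   separately. *)
set q := (X in X *: b.2).
have -> : q = 0.
  rewrite /q /spin_form /spin_diff !(linearBl, linearZl_LR) /=.
  rewrite !(BC b.2) (BC d.2 a.2) (BC d.2 c.2) (BC c.2 a.2); ring.
(* Each of [a.2], [c.2], [d.2] now occurs twice, with opposite coefficients. *)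
rewrite scale0r add0r -!opprD !(qC b) !scalerBr !scalerA.
rewrite [_ d b * _ a b]mulrC [_ d b * _ c b]mulrC [_ a b * _ c b]mulrC.
by rewrite -addrA [w in _ + w]addrC [w in _ + w]addrA !(subrK, addrA) subrr oppr0.
Qed.
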